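(* For any integers $r,t,n$ with $3\le r<t\le \frac{n+r-2}{2}$ there exists a connected graph $G$ of order $n$ with $pd_s(G)=r$ and $dim_s(G)=t$.
   Context: Graphs are finite, simple, connected; $d_G$ is shortest-path distance, $d_G(x,W)=\min\{d_G(x,w):w\in W\}$. A vertex $v$ strongly resolves different vertices $x,y$ if $d_G(x,v)=d_G(x,y)+d_G(y,v)$ or $d_G(y,v)=d_G(y,x)+d_G(x,v)$; the strong metric dimension $dim_s(G)$ is the minimum size of a vertex set $S$ such that every two vertices are strongly resolved by some vertex of $S$. A set $W$ strongly resolves different vertices $x,y\notin W$ if $d_G(x,W)=d_G(x,y)+d_G(y,W)$ or $d_G(y,W)=d_G(y,x)+d_G(x,W)$. A vertex partition $\Pi$ is a strong resolving partition if every two different vertices in the same set of $\Pi$ are strongly resolved by some set of $\Pi$; $pd_s(G)$ is the minimum cardinality of such a partition. *)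

(* Defs.v *)
From HB Require Import structures.
From mathcomp Require Import all_boot.

Set Implicit Arguments.
Unset Strict Implicit.
Unset Printing Implicit Defensive.

Record sgraph := SGraph {
  vertex :> finType;
  adj : rel vertex;
  adj_sym : symmetric adj;
  adj_irrefl : irreflexive adj
}.

Section Graph.
Variable G : sgraph.
Implicit Types (x y v : G) (W S : {set G}) (P : {set {set G}}).

Definition connected := forall x y, connect (@adj G) x y.

Definition has_walk x y (k : nat) :=
  [exists p : k.-tuple G, path (@adj G) x p && (last x p == y)].

(* Walks of length at least #|G| are never shortest, so the lengths range over
   k < #|G|; #|G| itself is the value when y is unreachable from x. *)
Definition dist x y : nat :=
  \big[minn/#|G|]_(k < #|G| | has_walk x y k) k.

(* #|G| bounds every distance, so this is the minimum over W, unless W is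
   empty. *)
Definition dist_set x W : nat := \big[minn/#|G|]_(w in W) dist x w.

Definition strongly_resolves v x y : bool :=
  (dist x v == dist x y + dist y v) || (dist y v == dist y x + dist x v).

Definition strong_resolving_set S : bool :=
  [forall x, forall y, (x != y) ==> [exists v in S, strongly_resolves v x y]].

(* setT is only the witness demanded by arg min; see dim_s_min. *)
Definition dim_s : nat :=
  #|[arg min_(S < [set: G] | strong_resolving_set S) #|S|]|.

Definition set_strongly_resolves W x y : bool :=
  [&& x \notin W, y \notin W &
      (dist_set x W == dist x y + dist_set y W)
   || (dist_set y W == dist y x + dist_set x W)].

Definition strong_resolving_partition P : bool :=
  partition P [set: G] &&
  [forall U in P, forall x in U, forall y in U,
     (x != y) ==> [exists W in P, set_strongly_resolves W x y]].

(* As above, the partition into singletons is only a witness; see pd_s_min. *)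
Definition pd_s : nat :=
  #|[arg min_(P < [set [set x] | x : G] | strong_resolving_partition P) #|P|]|.

Lemma bigmin_le (I : finType) (Q : pred I) (F : I -> nat) m i :
  Q i -> \big[minn/m]_(j | Q j) F j <= F i.
Proof.
move=> Qi; elim: (index_enum I) (mem_index_enum i) => // j s IHs.
rewrite inE big_cons => /predU1P[<-|/IHs le_s]; first by rewrite Qi geq_minl.
by case: ifP => // _; rewrite geq_min le_s orbT.
Qed.

Lemma bigmin_attained (I : finType) (Q : pred I) (F : I -> nat) m :
  (forall i, Q i -> F i <= m) -> (exists i, Q i) ->
  exists2 i, Q i & \big[minn/m]_(j | Q j) F j = F i.
Proof.
move=> Fm [i0 Qi0].
have [E|[i [Qi E]]] : \big[minn/m]_(j | Q j) F j = m \/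
    exists i, Q i /\ \big[minn/m]_(j | Q j) F j = F i.
  elim/big_ind: _ => [|a b Ha Hb|i Qi]; [by left| |by right; exists i].
  by rewrite /minn; case: ifP.
- exists i0 => //; apply/eqP; rewrite eqn_leq bigmin_le //= E.
  exact: Fm.
- by exists i.
Qed.

Lemma dist_le x p : path (@adj G) x p -> dist x (last x p) <= size p.
Proof.
move=> pP; case/shortenP: pP => q pq uq sq.
apply: (@leq_trans (size q)); last first.
  by apply: uniq_leq_size => //; case/andP: uq.
have ltq : size q < #|G|.
  by rewrite -[_.+1]/(size (x :: q)) -(card_uniqP uq) max_card.
apply: (@bigmin_le 'I_#|G| (fun k => has_walk x (last x q) k) (fun k => k)
  #|G| (Ordinal ltq)).
by apply/existsP; exists (in_tuple q); rewrite pq /=.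
Qed.

Lemma dist_attained x y : connect (@adj G) x y ->
  exists p, [/\ path (@adj G) x p, last x p = y & size p = dist x y].
Proof.
case/connectP=> p pP ->; case/shortenP: pP => q pq uq _.
have ltq : size q < #|G|.
  by rewrite -[_.+1]/(size (x :: q)) -(card_uniqP uq) max_card.
have [|| k /existsP[s /andP[ps /eqP ls]] E] :=
  @bigmin_attained 'I_#|G| (fun k => has_walk x (last x q) k) (fun k => k) #|G|.
- by move=> i _; apply: ltnW.
- by exists (Ordinal ltq); apply/existsP; exists (in_tuple q); rewrite pq /=.
- by exists s; split=> //; rewrite size_tuple /dist -E.
Qed.

Lemma dist_leT x y : dist x y <= #|G|.
Proof.
rewrite /dist; elim/big_ind: _ => // [a b Ha _|i _]; last exact: ltnW.
by rewrite geq_min Ha.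
Qed.

Lemma dist_set_le x W w : w \in W -> dist_set x W <= dist x w.
Proof. exact: bigmin_le. Qed.

Lemma dist_set_attained x W : W != set0 ->
  exists2 w, w \in W & dist_set x W = dist x w.
Proof.
move=> /set0Pn W0; apply: bigmin_attained => // w _; exact: dist_leT.
Qed.

Lemma distxx x : dist x x = 0.
Proof. by apply/eqP; rewrite -leqn0 (dist_le (p := [::])). Qed.

Lemma dim_s_min :
  (exists2 S, strong_resolving_set S & #|S| = dim_s) /\
  (forall S, strong_resolving_set S -> dim_s <= #|S|).
Proof.
rewrite /dim_s; case: arg_minnP => [|S PS minS]; last first.
  by split=> //; exists S.
apply/forallP=> x; apply/forallP=> y; apply/implyP=> _.
apply/existsP; exists x; rewrite in_setT /strongly_resolves.
by rewrite distxx addn0 eqxx orbT.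
Qed.

Lemma pd_s_min :
  (exists2 P, strong_resolving_partition P & #|P| = pd_s) /\
  (forall P, strong_resolving_partition P -> pd_s <= #|P|).
Proof.
rewrite /pd_s; case: arg_minnP => [|P PP minP]; last first.
  by split=> //; exists P.
apply/andP; split; last first.
  apply/forall_inP=> U /imsetP[z _ ->].
  apply/forall_inP=> x /set1P->; apply/forall_inP=> y /set1P->.
  by rewrite eqxx.
apply/and3P; split.
- apply/eqP/setP=> x; rewrite in_setT; apply/bigcupP.
  by exists [set x]; rewrite ?set11 // imset_f.
- apply/trivIsetP=> _ _ /imsetP[x _ ->] /imsetP[y _ ->] nxy.
  rewrite disjoints1 in_set1; apply: contraNneq nxy => -> //.
- by apply/imsetP=> [[x _ /setP/(_ x)]]; rewrite !inE eqxx.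
Qed.

End Graph.

(* Main.v *)
Require Import Defs.
From mathcomp Require Import all_boot zify.

(** Two vertices that are maximally distant from each other are strongly
    resolved by a vertex only if it is one of them, and by no set at all; so a
    strong resolving set is a vertex cover of the graph of such pairs, and a
    strong resolving partition is a proper coloring of it.

    Attach to a vertex v of an odd cycle of length 2k + 1 >= 5 one pendant path
    with m >= 1 edges and r - 2 pendant edges.  The mutually maximally distant
    pairs are the pairs among the r - 1 leaves, the pairs formed of a leaf and
    one of the two antipodes of v, and the pairs of cycle vertices other than v
    at distance k.  The leaves and one antipode of v form a clique of size r,
    and every vertex cover has at least r - 1 + k elements.  Both bounds are
    attained, so k = t - r + 1 and m = n - 2k - r + 1 give the theorem. *)

(** * Recognizing a distance function; bounds from mutually maximally distant pairs *)

Section Distances.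
Variable G : sgraph.
Implicit Types (x y z : G) (S W : {set G}).

(** Descent along edges produces a walk of length [D x y], and the Lipschitz condition bounds the
    length of every walk from below by [D]. *)
Lemma connected_distP (D : G -> G -> nat) :
    (forall x, D x x = 0) ->
    (forall x y z, adj x z -> D x y <= (D z y).+1) ->
    (forall x y, x != y -> exists2 z, adj x z & D x y = (D z y).+1) ->
  connected G /\ forall x y, dist x y = D x y.
Proof.
move=> D0 Dlip Ddesc.
have geo x y : exists p, [/\ path (@adj G) x p, last x p = y & size p = D x y].
  move En: (D x y) => m; elim: m x En => [|m IHm] x En.
    have [<-|/Ddesc[z _]] := eqVneq x y; first by exists [::].
    by rewrite En.
  have [exy|/Ddesc[z xz Dz]] := eqVneq x y; first by rewrite exy D0 in En.
  have [|p [pz lz sz]] := IHm z; first by rewrite En in Dz; case: Dz.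
  by exists (z :: p); rewrite /= xz pz lz sz.
have cG : connected G.
  by move=> x y; have [p [px lx _]] := geo x y; apply/connectP; exists p.
split=> // x y; apply/eqP; rewrite eqn_leq; apply/andP; split.
  by have [p [px <- <-]] := geo x y; apply: dist_le.
have [p [px <- <-]] := dist_attained (cG x y).
elim: p x px {y} => [|z p IHp] x /=; first by rewrite D0.
by case/andP=> xz pz; apply: leq_trans (Dlip _ _ _ xz) _; rewrite ltnS IHp.
Qed.

Lemma dist_set_eq x W w :
  w \in W -> (forall z, z \in W -> dist x w <= dist x z) ->
  dist_set x W = dist x w.
Proof.
move=> Ww le_w; apply/eqP; rewrite eqn_leq dist_set_le //=.
have [|z Wz ->] := @dist_set_attained G x W; last exact: le_w.
by apply/set0Pn; exists w.
Qed.

(** Strictness says that no geodesic from one of the two vertices extends beyond the other; in a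
    connected graph this is equivalent to the usual condition on neighbours. *)
Definition mmd x y :=
  (forall z, z != y -> dist x z < dist x y + dist y z) /\
  (forall z, z != x -> dist y z < dist y x + dist x z).

Lemma mmd_sym x y : mmd x y -> mmd y x.
Proof. by case. Qed.

Lemma strong_resolving_set_mmd S x y :
  strong_resolving_set S -> x != y -> mmd x y -> (x \in S) || (y \in S).
Proof.
move=> /forallP/(_ x)/forallP/(_ y)/implyP resS /resS /existsP[v /andP[Sv]].
move=> res [maxy maxx]; have [<-|vy] := eqVneq v y; first by rewrite Sv orbT.
have [<-|vx] := eqVneq v x; first by rewrite Sv.
by case/orP: res => /eqP E; [have := maxy v vy|have := maxx v vx];
  rewrite E ltnn.
Qed.

(** A vertex [w] of [W] nearest to [v] differs from [v], so [dist_set u W <= dist u w < dist u v +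
    dist v w], and the last term is [dist_set v W]. *)
Lemma set_strongly_resolves_mmd W x y :
  W != set0 -> mmd x y -> ~~ set_strongly_resolves W x y.
Proof.
move=> W0; suff far u v : v \notin W ->
    (forall z, z != v -> dist u z < dist u v + dist v z) ->
    dist_set u W != dist u v + dist_set v W.
  by case=> maxy maxx; apply/and3P=> -[xW yW /orP[]]; apply/negP/far.
move=> vW maxv; have [w Ww ->] := dist_set_attained v W0.
rewrite neq_ltn (leq_ltn_trans (dist_set_le u Ww)) // maxv //.
by apply: contraNneq vW => <-.
Qed.

(** No block resolves two vertices of [Q], so they lie in different blocks and [pblock P] is
    injective on [Q]. *)
Lemma strong_resolving_partition_mmd (P : {set {set G}}) (Q : {set G}) :
    strong_resolving_partition P -> {in Q &, forall x y, x != y -> mmd x y} ->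
  #|Q| <= #|P|.
Proof.
case/andP=> partP /forall_inP resP mmdQ.
have /and3P[/eqP covP trivP P0] := partP.
have injQ : {in Q &, injective (pblock P)}.
  move=> x y Qx Qy eq_xy; apply/eqP/negP=> /negP xy.
  have PxP z : z \in cover P by rewrite covP inE.
  have xx := mem_pblock P x; rewrite PxP in xx.
  have yx : y \in pblock P x by rewrite eq_xy mem_pblock PxP.
  have /resP/forall_inP/(_ x xx)/forall_inP/(_ y yx) := pblock_mem (PxP x).
  rewrite xy /= => /existsP[W /andP[PW]]; apply/negP.
  apply: set_strongly_resolves_mmd (mmdQ _ _ Qx Qy xy).
  by apply: contraNneq P0 => <-.
rewrite -(card_in_imset injQ); apply: subset_leq_card.
by apply/subsetP=> _ /imsetP[x _ ->]; apply: pblock_mem; rewrite covP inE.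
Qed.

Lemma strong_resolving_fibers r (c : G -> 'I_r) :
    (forall i, exists x, c x = i) ->
    (forall x y, x != y -> c x = c y ->
       exists i, set_strongly_resolves [set z | c z == i] x y) ->
  strong_resolving_partition [set [set z | c z == i] | i : 'I_r].
Proof.
move=> surj res; apply/andP; split; first (apply/and3P; split).
- apply/eqP/setP=> x; rewrite inE; apply/bigcupP.
  by exists [set z | c z == c x]; rewrite ?imset_f // inE.
- apply/trivIsetP=> _ _ /imsetP[i _ ->] /imsetP[j _ ->] ij.
  rewrite -setI_eq0; apply/eqP/setP=> x; rewrite !inE.
  by apply: contraNF ij => /andP[/eqP-> /eqP->].
- apply/imsetP=> -[i _ /setP]; have [x xi] := surj i.
  by move/(_ x); rewrite !inE xi eqxx.
apply/forall_inP=> _ /imsetP[i _ ->].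
apply/forall_inP=> x; rewrite inE => /eqP xi.
apply/forall_inP=> y; rewrite inE => /eqP yi.
apply/implyP=> xy; have [|j resj] := res x y xy; first by rewrite xi.
by apply/existsP; exists [set z | c z == j]; rewrite imset_f.
Qed.

End Distances.

Arguments mmd {G} x y.

(** * Distances in the cycle with pendant paths, as arithmetic on vertex numbers *)

Section Tadpole.
Variables k m : nat.

(** The cycle is numbered 0, ..., 2k, with the pendant path 2k + 1, ..., 2k + m
    and the other leaves, 2k + m + 1 onwards, attached at 0. *)
Definition foot x := if x <= 2 * k then x else 0.

Definition height x :=
  if x <= 2 * k then 0 else if x <= 2 * k + m then x - 2 * k else 1.

Definition tail x := 2 * k < x <= 2 * k + m.

Definition absd a b := (a - b) + (b - a).

(** Unless both vertices lie on the pendant path, a geodesic between distinct vertices descends to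
    their feet and follows the shorter arc of the cycle. *)
Definition tdist x y :=
  if tail x && tail y then absd x y else
  if x == y then 0 else
  height x + height y +
    minn (absd (foot x) (foot y)) (2 * k + 1 - absd (foot x) (foot y)).

Lemma tdistC (x y : nat) : tdist x y = tdist y x.
Proof.
rewrite /tdist eq_sym andbC /absd; case: ifP => _; first by lia.
by case: ifP => // _; lia.
Qed.

Lemma tdistxx (x : nat) : tdist x x = 0.
Proof. by rewrite /tdist eqxx /absd; case: ifP => // _; lia. Qed.

(** Each case determines [d] by a linear equation without [minn] or truncated subtraction, ready for
    [lia]. *)
Variant tdist_spec x y : nat -> Prop :=
| TdistShort d of x <= y & y <= x + k & y <= 2 * k &
    d + x = y : tdist_spec x y d
| TdistLong d of x + k < y & y <= 2 * k &
    d + y = x + 2 * k + 1 : tdist_spec x y d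
| TdistShortC d of y < x & x <= y + k & x <= 2 * k &
    d + y = x : tdist_spec x y d
| TdistLongC d of y + k < x & x <= 2 * k &
    d + x = y + 2 * k + 1 : tdist_spec x y d
| TdistTail d of 2 * k < x & x <= y & y <= 2 * k + m &
    d + x = y : tdist_spec x y d
| TdistTailC d of 2 * k < y & y < x & x <= 2 * k + m &
    d + y = x : tdist_spec x y d
| TdistTailLow d of x <= k & 2 * k < y & y <= 2 * k + m &
    d + 2 * k = x + y : tdist_spec x y d
| TdistTailHigh d of k < x & x <= 2 * k & 2 * k < y & y <= 2 * k + m &
    d + x = y + 1 : tdist_spec x y d
| TdistLowTail d of y <= k & 2 * k < x & x <= 2 * k + m &
    d + 2 * k = x + y : tdist_spec x y d
| TdistHighTail d of k < y & y <= 2 * k & 2 * k < x & x <= 2 * k + m &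
    d + y = x + 1 : tdist_spec x y d
| TdistLeafLow d of x <= k & 2 * k + m < y & d = x + 1 : tdist_spec x y d
| TdistLeafHigh d of k < x & x <= 2 * k & 2 * k + m < y &
    d + x = 2 * k + 2 : tdist_spec x y d
| TdistLowLeaf d of y <= k & 2 * k + m < x & d = y + 1 : tdist_spec x y d
| TdistHighLeaf d of k < y & y <= 2 * k & 2 * k + m < x &
    d + y = 2 * k + 2 : tdist_spec x y d
| TdistTailLeaf d of 2 * k < x & x <= 2 * k + m & 2 * k + m < y &
    d + 2 * k = x + 1 : tdist_spec x y d
| TdistLeafTail d of 2 * k < y & y <= 2 * k + m & 2 * k + m < x &
    d + 2 * k = y + 1 : tdist_spec x y d
| TdistLeafEq d of 2 * k + m < x & x = y & d = 0 : tdist_spec x y d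
| TdistLeafNeq d of 2 * k + m < x & 2 * k + m < y & x != y &
    d = 2 : tdist_spec x y d.

Lemma tdistP (x y : nat) : tdist_spec x y (tdist x y).
Proof.
have [xc|xc] := leqP x (2 * k); last have [xt|xt] := leqP x (2 * k + m);
(have [yc|yc] := leqP y (2 * k); last have [yt|yt] := leqP y (2 * k + m));
rewrite /tdist /tail /height /foot /absd ?(ltnNge (2 * k)) ?xc ?yc
  ?(leqNgt x) ?(leqNgt y) ?xc ?yc ?xt ?yt -?leqNgt ?xt ?yt /= ?andbF /=;
  try (case: eqP => [eq_xy|/eqP xy]; first by [lia | apply: TdistLeafEq]).
- case: eqP => [->|/eqP xy]; first by apply: TdistShort; lia.
  have [le_xy|lt_yx] := leqP x y.
    have [?|?] := leqP y (x + k); [apply: TdistShort|apply: TdistLong]; lia.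
  have [?|?] := leqP x (y + k); [apply: TdistShortC|apply: TdistLongC]; lia.
- have [?|?] := leqP x k; [apply: TdistTailLow|apply: TdistTailHigh]; lia.
- have [?|?] := leqP x k; [apply: TdistLeafLow|apply: TdistLeafHigh]; lia.
- have [?|?] := leqP y k; [apply: TdistLowTail|apply: TdistHighTail]; lia.
- have [?|?] := leqP x y; [apply: TdistTail|apply: TdistTailC]; lia.
- by apply: TdistTailLeaf; lia.
- have [?|?] := leqP y k; [apply: TdistLowLeaf|apply: TdistHighLeaf]; lia.
- by apply: TdistLeafTail; lia.
- by apply: TdistLeafNeq; lia.
Qed.

Ltac tlia := repeat
  match goal with
  | |- context [tdist ?x ?y] => case: (tdistP x y) => *; try (exfalso; lia)
  end; lia.

(** The vertex [z] is the next one on a geodesic from [x] to [y]. The numbering is consecutive along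
    it except at the edges joining 0 to [2 * k], to [2 * k + 1] and to the leaves. *)
Lemma tdist_descent (n x y : nat) :
    1 < k -> 0 < m -> 2 * k + m < n -> x < n -> y < n -> x <> y ->
  exists2 z, z < n & tdist x z = 1 /\ tdist x y = (tdist z y).+1.
Proof.
move=> k1 m0 nkm xn yn xy.
have step z : z < n -> tdist x z = 1 -> tdist x y = (tdist z y).+1 ->
    exists2 z, z < n & tdist x z = 1 /\ tdist x y = (tdist z y).+1.
  by exists z.
case Ed: _ / (tdistP x y) => [d|d|d|d|d|d|d|d|d|d|d|d|d|d|d|d|d|d] *;
  rewrite -?Ed.
- by apply: (step x.+1); tlia.
(* The shorter arc goes down from [x] and wraps around from 0 to [2 * k]. *)
- have [x0|x0] := eqVneq x 0; last by apply: (step x.-1); tlia.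
  by apply: (step (2 * k)); tlia.
- by apply: (step x.-1); tlia.
- have [xk|xk] := eqVneq x (2 * k); last by apply: (step x.+1); tlia.
  by apply: (step 0); tlia.
- by apply: (step x.+1); tlia.
- by apply: (step x.-1); tlia.
- have [x0|x0] := eqVneq x 0; last by apply: (step x.-1); tlia.
  by apply: (step (2 * k).+1); tlia.
- have [xk|xk] := eqVneq x (2 * k); last by apply: (step x.+1); tlia.
  by apply: (step 0); tlia.
- have [xk|xk] := eqVneq x (2 * k).+1; last by apply: (step x.-1); tlia.
  by apply: (step 0); tlia.
- have [xk|xk] := eqVneq x (2 * k).+1; last by apply: (step x.-1); tlia.
  by apply: (step 0); tlia.
- have [x0|x0] := eqVneq x 0; last by apply: (step x.-1); tlia.
  by apply: (step y); tlia.
- have [xk|xk] := eqVneq x (2 * k); last by apply: (step x.+1); tlia.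
  by apply: (step 0); tlia.
- by apply: (step 0); tlia.
- by apply: (step 0); tlia.
- have [xk|xk] := eqVneq x (2 * k).+1; last by apply: (step x.-1); tlia.
  by apply: (step 0); tlia.
- by apply: (step 0); tlia.
- by lia.
- by apply: (step 0); tlia.
Qed.

(** One half of [mmd], with [z] ranging over all naturals: numbers beyond the order of the graph act
    as further leaves at 0. *)
Definition tmax x y :=
  forall z : nat, z != y -> tdist x z < tdist x y + tdist y z.

(** The number [2 * k + m] is the end of the pendant path, which counts as a leaf. *)
Lemma tmax_leaves (x y : nat) :
  0 < m -> x != y -> 2 * k + m <= x -> 2 * k + m <= y -> tmax x y.
Proof. by move=> m0 xy xm ym z zy; tlia. Qed.

Lemma tmax_leaf_antipode (x y : nat) :
    1 < k -> 0 < m -> 2 * k + m <= x -> k <= y <= k.+1 ->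
  tmax x y /\ tmax y x.
Proof. by move=> k1 m0 xm yk; split=> z zy; tlia. Qed.

(** Vertex 0 is excluded because geodesics arriving there continue into the pendant path and
    edges. *)
Lemma tmax_antipodes (x y : nat) :
    0 < x -> x + k <= y <= x + k.+1 -> y <= 2 * k ->
  tmax x y /\ tmax y x.
Proof. by move=> x0 xy yk; split=> z zy; tlia. Qed.

(** Classes 0 and 1 lie on geodesics from a leaf to k and to k + 1, the two
    elements of class 2; the other classes are single leaves. *)
Definition tclass x :=
  if x == 0 then 1 else if x < k then 0 else if x <= k.+1 then 2 else
  if x <= 2 * k then 1 else if x <= 2 * k + m then 0 else
  if x == (2 * k + m).+1 then 1 else (x - (2 * k + m)).+1.

Variant tclass_spec x : nat -> Prop :=
| TclassRoot c of x = 0 & c = 1 : tclass_spec x c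
| TclassNear c of 0 < x & x < k & c = 0 : tclass_spec x c
| TclassAntipode c of k <= x & x <= k.+1 & c = 2 : tclass_spec x c
| TclassFar c of k.+1 < x & x <= 2 * k & c = 1 : tclass_spec x c
| TclassTail c of 2 * k < x & x <= 2 * k + m & c = 0 : tclass_spec x c
| TclassLeaf1 c of x = (2 * k + m).+1 & c = 1 : tclass_spec x c
| TclassLeaf c of (2 * k + m).+1 < x & c + (2 * k + m) = x.+1 :
    tclass_spec x c.

Lemma tclassP (x : nat) : 1 < k -> tclass_spec x (tclass x).
Proof.
move=> k1; rewrite /tclass.
have [x0|x0] := eqVneq x 0; first by constructor 1.
have [xk|xk] := ltnP x k; first by constructor 2; lia.
have [xk1|xk1] := leqP x k.+1; first by constructor 3.
have [x2k|x2k] := leqP x (2 * k); first by constructor 4.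
have [xt|xt] := leqP x (2 * k + m); first by constructor 5.
by have [xl|xl] := eqVneq x (2 * k + m).+1; [constructor 6|constructor 7; lia].
Qed.

(** The inequality makes [k] the nearest element of class 2, so the geodesic to [k] shows that class
    2 resolves [x] and [y]. *)
Lemma tclass0_geodesic (x y : nat) : 1 < k -> tclass x = 0 -> tclass y = 0 ->
  tdist x k <= tdist x k.+1 /\
  (tdist x k = tdist x y + tdist y k \/ tdist y k = tdist y x + tdist x k).
Proof.
move=> k1; case: (tclassP x) => // c; case: (tclassP y) => // c' *;
  by rewrite ?(tdistC y x); split; tlia.
Qed.

Lemma tclass1_geodesic (x y : nat) : 1 < k -> tclass x = 1 -> tclass y = 1 ->
  tdist x k.+1 <= tdist x k /\
  (tdist x k.+1 = tdist x y + tdist y k.+1 \/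
   tdist y k.+1 = tdist y x + tdist x k.+1).
Proof.
move=> k1; case: (tclassP x) => // c; case: (tclassP y) => // c' *;
  by rewrite ?(tdistC y x); split; tlia.
Qed.

(** Serves to resolve the pair [k], [k.+1] by class 0: its nearest element to both is [k.-1], and
    [k] lies between [k.+1] and [k.-1]. *)
Lemma tclass0_nearest (x : nat) : 1 < k -> tclass x = 0 ->
  tdist k k.-1 <= tdist k x /\ tdist k.+1 k.-1 <= tdist k.+1 x.
Proof.
by move=> k1; case: (tclassP x) => // c *; split; tlia.
Qed.

Lemma tdist_antipodes : 1 < k -> tdist k.+1 k.-1 = tdist k.+1 k + tdist k k.-1.
Proof. by move=> k1; tlia. Qed.

Lemma tclass_eq2 (x : nat) : 1 < k -> tclass x = 2 -> x = k \/ x = k.+1.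
Proof. by move=> k1; case: tclassP => // c *; lia. Qed.

Lemma tclass_ge3 (x y : nat) : 1 < k -> 2 < tclass x -> tclass x = tclass y ->
  x = y.
Proof. by move=> k1; case: tclassP => // c; case: tclassP => // c' *; lia. Qed.

(** The vertices allowed here lie on the single geodesic [k + 1, ..., 2 * k, 0, 2 * k + 1, ..., 2 *
    k + m]. *)
Lemma tdist_tail_end (x y : nat) : 1 < k -> 0 < m ->
    ~~ (0 < x <= k) -> ~~ (0 < y <= k) -> x < 2 * k + m -> y < 2 * k + m ->
  tdist x (2 * k + m) = tdist x y + tdist y (2 * k + m) \/
  tdist y (2 * k + m) = tdist y x + tdist x (2 * k + m).
Proof. by move=> *; rewrite ?(tdistC y x); tlia. Qed.

Lemma tdist_lip (x y z : nat) : tdist x z = 1 -> tdist x y <= (tdist z y).+1.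
Proof. tlia. Qed.

End Tadpole.

(** * The graph and its mutually maximally distant pairs *)

Section TadpoleGraph.
Variables k m r : nat.
Hypotheses (r3 : 2 < r) (k1 : 1 < k) (m0 : 0 < m).
(** There are [2 * k + 1] cycle vertices, [m] path vertices and [r - 2] other leaves; the [r - 1]
    leaves are the numbers from [2 * k + m] on. *)
Let n := 2 * k + m + r - 1.

Definition tadj (x y : 'I_n) := tdist k m x y == 1.

Fact tadj_sym : symmetric tadj.
Proof. by move=> x y; rewrite /tadj tdistC. Qed.

Fact tadj_irrefl : irreflexive tadj.
Proof. by move=> x; rewrite /tadj tdistxx. Qed.

Definition tadpole := SGraph tadj_sym tadj_irrefl.

Lemma tadpole_dist :
  connected tadpole /\ forall x y : tadpole, dist x y = tdist k m x y.
Proof.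
apply: (@connected_distP tadpole (fun x y : 'I_n => tdist k m x y)).
- by move=> x; apply: tdistxx.
- by move=> x y z /eqP; apply: tdist_lip.
move=> x y /eqP xy; have [||z zn [xz E]] :=
  @tdist_descent k m n x y k1 m0 _ (ltn_ord x) (ltn_ord y).
- by rewrite /n; lia.
- by move=> /val_inj/xy.
- by exists (Ordinal zn); rewrite // /adj /= /tadj xz.
Qed.

Let o0 : 0 < n. Proof. by rewrite /n; lia. Qed.

(** Total on the naturals, so that indices can be computed freely; those outside the range give
    vertex 0. *)
Definition tvertex i : tadpole := insubd (Ordinal o0) i.

Lemma tvertexK i : i < n -> val (tvertex i) = i :> nat.
Proof. by move=> i_n; rewrite /tvertex insubdK. Qed.

Lemma tvertex_inj i j : i < n -> j < n -> tvertex i = tvertex j -> i = j.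
Proof. by move=> i_n j_n /(congr1 val); rewrite !tvertexK. Qed.

Lemma tmax_mmd i j :
  i < n -> j < n -> tmax k m i j -> tmax k m j i -> mmd (tvertex i) (tvertex j).
Proof.
move=> i_n j_n ij ji.
by split=> z zn; rewrite !(tadpole_dist.2) !tvertexK //;
   [apply: ij|apply: ji]; apply: contra zn => /eqP E; apply/eqP/val_inj;
   rewrite /= tvertexK.
Qed.

Lemma mmd_leaves i j : i != j -> 2 * k + m <= i < n -> 2 * k + m <= j < n ->
  mmd (tvertex i) (tvertex j).
Proof.
move=> ij /andP[im i_n] /andP[jm j_n].
by apply: tmax_mmd => //; apply: tmax_leaves; rewrite // eq_sym.
Qed.

Lemma mmd_leaf_antipode i j : 2 * k + m <= i < n -> k <= j <= k.+1 ->
  mmd (tvertex i) (tvertex j).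
Proof.
move=> /andP[im i_n] jk; have [ij ji] := tmax_leaf_antipode _ _ _ _ k1 m0 im jk.
by apply: tmax_mmd; rewrite // /n; lia.
Qed.

Lemma mmd_antipodes i j : 0 < i -> i + k <= j <= i + k.+1 -> j <= 2 * k ->
  mmd (tvertex i) (tvertex j).
Proof.
move=> i0 ij jk; have [ij' ji] := tmax_antipodes k m i j i0 ij jk.
by apply: tmax_mmd; rewrite // /n; lia.
Qed.

(** * The strong partition dimension *)

Lemma leq_pd_s_tadpole : r <= pd_s tadpole.
Proof.
have [[P resP <-] _] := pd_s_min tadpole.
(* The clique of size [r]: the antipode [k] and the [r - 1] leaves. *)
pose q (i : 'I_r) := if i == 0 :> nat then k else 2 * k + m + i.-1.
have qn i : q i < n by have := ltn_ord i; rewrite /q /n; case: ifP => *; lia.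
have q_inj : injective (tvertex \o q).
  move=> i j /(tvertex_inj _ _ (qn i) (qn j)) E; apply: val_inj => /=.
  move: E; rewrite /q.
  by case: (eqVneq (i : nat) 0) => i0; case: (eqVneq (j : nat) 0) => j0; lia.
rewrite -[r]card_ord -cardsT -(card_imset _ q_inj).
apply: (strong_resolving_partition_mmd _ _ _ resP).
move=> _ _ /imsetP[i _ ->] /imsetP[j _ ->] /eqP; have := qn i.
have := qn j; rewrite /= /q.
case: (eqVneq (i : nat) 0) => i0; case: (eqVneq (j : nat) 0) => j0 // jn i_n ij.
- by apply: mmd_sym; apply: mmd_leaf_antipode; lia.
- by apply: mmd_leaf_antipode; lia.
- by apply: mmd_leaves; try lia; apply/eqP=> E; apply: ij; rewrite E.
Qed.

Lemma tclass_lt (x : 'I_n) : tclass k m x < r.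
Proof. by have := ltn_ord x; rewrite {2}/n; case: tclassP => // c *; lia. Qed.

Definition color (x : tadpole) : 'I_r := Ordinal (tclass_lt x).

Lemma color_surj (i : 'I_r) : exists x, color x = i.
Proof.
have i_r := ltn_ord i.
suff [v v_n cv]: exists2 v, v < n & tclass k m v = i.
  by exists (tvertex v); apply: val_inj; rewrite /= tvertexK.
have [i0|i0] := eqVneq (i : nat) 0.
  by exists 1; [rewrite /n; lia | case: tclassP; lia].
have [i1|i1] := eqVneq (i : nat) 1.
  by exists 0; [rewrite /n; lia | case: tclassP; lia].
have [i2|i2] := eqVneq (i : nat) 2.
  by exists k; [rewrite /n; lia | case: tclassP; lia].
by exists (2 * k + m + i).-1; [rewrite /n; lia | case: tclassP; lia].
Qed.

(** When one vertex [w] of the class is nearest to both [x] and [y], distances to the class become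
    distances to [w]. *)
Lemma strongly_resolves_color i (x y w : tadpole) :
    color x = color y -> color x != i -> color w = i ->
    (forall z, color z = i -> dist x w <= dist x z) ->
    (forall z, color z = i -> dist y w <= dist y z) ->
    dist x w = dist x y + dist y w \/ dist y w = dist y x + dist x w ->
  set_strongly_resolves [set z | color z == i] x y.
Proof.
move=> xy xi wi xw yw res.
have Ww : w \in [set z | color z == i] by rewrite inE wi.
rewrite /set_strongly_resolves !inE -xy xi /=.
rewrite !(dist_set_eq _ _ _ _ Ww) => [|z|z].
- by case: res => /eqP ->; rewrite ?orbT.
- by rewrite inE => /eqP/yw.
- by rewrite inE => /eqP/xw.
Qed.

Lemma pd_s_tadpole : pd_s tadpole = r.
Proof.
apply/eqP; rewrite eqn_leq leq_pd_s_tadpole andbT.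
pose P := [set [set z | color z == i] | i : 'I_r].
suff resP : strong_resolving_partition P.
  apply: leq_trans (proj2 (pd_s_min _) _ resP) _.
  by rewrite -[X in _ <= X]card_ord leq_imset_card.
apply: (strong_resolving_fibers _ _ _ color_surj) => x y xy cxy.
have k_n : k < n by rewrite /n; lia.
have k1_n : k.+1 < n by rewrite /n; lia.
have cE z i : color z = i -> tclass k m z = i by move=> <-.
have distE := tadpole_dist.2.
have cyx : tclass k m y = tclass k m x by case: cxy.
(* Class 2 resolves the pairs within class 0 through [k], and those within class 1 through
   [k.+1]. *)
have [cx0|cx0] := eqVneq (tclass k m x) 0.
  rewrite cx0 in cyx; have [xk res] := tclass0_geodesic _ _ _ _ k1 cx0 cyx.
  have [yk _] := tclass0_geodesic _ _ _ _ k1 cyx cx0.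
  exists (Ordinal r3); apply: (strongly_resolves_color _ _ _ (tvertex k)) => //.
  - by apply/eqP=> /(congr1 val) /=; rewrite cx0.
  - by apply: val_inj; rewrite /= tvertexK //; case: tclassP; lia.
  - by move=> z /cE/(tclass_eq2 _ _ _ k1)[|] zE; rewrite !distE zE tvertexK.
  - by move=> z /cE/(tclass_eq2 _ _ _ k1)[|] zE; rewrite !distE zE tvertexK.
  - by rewrite !distE tvertexK.
have [cx1|cx1] := eqVneq (tclass k m x) 1.
  rewrite cx1 in cyx; have [xk res] := tclass1_geodesic _ _ _ _ k1 cx1 cyx.
  have [yk _] := tclass1_geodesic _ _ _ _ k1 cyx cx1.
  exists (Ordinal r3).
  apply: (strongly_resolves_color _ _ _ (tvertex k.+1)) => //.
  - by apply/eqP=> /(congr1 val) /=; rewrite cx1.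
  - by apply: val_inj; rewrite /= tvertexK //; case: tclassP; lia.
  - by move=> z /cE/(tclass_eq2 _ _ _ k1)[|] zE; rewrite !distE zE tvertexK.
  - by move=> z /cE/(tclass_eq2 _ _ _ k1)[|] zE; rewrite !distE zE tvertexK.
  - by rewrite !distE tvertexK.
have [cx2|cx2] := eqVneq (tclass k m x) 2; last first.
  have x3 : 2 < tclass k m x by lia.
  by case/eqP: xy; apply: val_inj; apply: (tclass_ge3 _ _ _ _ k1 x3).
(* The remaining pair consists of [k] and [k.+1]; class 0 resolves it through [k.-1]. *)
rewrite cx2 in cyx.
have p_n : k.-1 < n by rewrite /n; lia.
have r0 : 0 < r by apply: leq_trans r3.
have near z : color z = Ordinal r0 ->
    tdist k m k k.-1 <= tdist k m k z /\
    tdist k m k.+1 k.-1 <= tdist k m k.+1 z.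
  by move=> /cE; apply: tclass0_nearest.
exists (Ordinal r0).
apply: (strongly_resolves_color _ _ _ (tvertex k.-1)) => //.
- by apply: val_inj; rewrite /= tvertexK //; case: tclassP; lia.
- move=> z /near[zk zk1]; rewrite !distE tvertexK //.
  by case: (tclass_eq2 _ _ _ k1 cx2) => ->.
- move=> z /near[zk zk1]; rewrite !distE tvertexK //.
  by case: (tclass_eq2 _ _ _ k1 cyx) => ->.
rewrite !distE tvertexK //.
have : x <> y :> nat by move=> /val_inj/eqP; apply/negP.
case: (tclass_eq2 _ _ _ k1 cx2) => ->;
  case: (tclass_eq2 _ _ _ k1 cyx) => -> // _;
  have := tdist_antipodes k m k1; [right|left]; rewrite // tdistC.
Qed.

(** * The strong metric dimension *)

Lemma leq_dim_s_tadpole : r.-1 + k <= dim_s tadpole.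
Proof.
have [[S resS <-] _] := dim_s_min tadpole.
have hit i j : i < n -> j < n -> i != j -> mmd (tvertex i) (tvertex j) ->
    (tvertex i \in S) || (tvertex j \in S).
  move=> i_n j_n ij; apply: strong_resolving_set_mmd => //.
  by apply: contra ij => /eqP/(tvertex_inj _ _ i_n j_n)->.
(* The lower bound is reduced to listing [r.-1 + k] distinct vertex numbers with vertices in [S]. *)
suff [a [a_n aS a_inj]] : exists a : nat -> nat,
    [/\ forall i, i < r.-1 + k -> a i < n,
        forall i, i < r.-1 + k -> tvertex (a i) \in S &
        forall i j, i < r.-1 + k -> j < r.-1 + k -> a i = a j -> i = j].
  pose f (i : 'I_(r.-1 + k)) := tvertex (a i).
  have f_inj : injective f.
    move=> i j /(tvertex_inj _ _ (a_n _ (ltn_ord i)) (a_n _ (ltn_ord j))).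
    by move=> E; apply: val_inj; apply: a_inj E.
  rewrite -[_ + _]card_ord -cardsT -(card_imset _ f_inj).
  by apply/subset_leq_card/subsetP=> _ /imsetP[i _ ->]; apply: aS.
(* The k pairs (j, j + k) are disjoint; when a leaf is missing from S, both
   antipodes of 0 are in S, and the k - 1 pairs (j, j + k + 1) avoid them. *)
have [l_ok|] := boolP [forall i : 'I_r.-1, tvertex (2 * k + m + i) \in S].
  pose b j := if tvertex j.+1 \in S then j.+1 else j.+1 + k.
  exists (fun i => if i < r.-1 then 2 * k + m + i else b (i - r.-1)).
  have bE j : b j = j.+1 \/ b j = j.+1 + k by rewrite /b; case: ifP; auto.
  split=> [i ik|i ik|i j ik jk].
  - by have := bE (i - r.-1); rewrite /n; case: ifP; lia.
  - case: ifP => [ir|ir]; first exact: (forallP l_ok (Ordinal ir)).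
    rewrite /b; case: ifP => // E.
    move: (hit (i - r.-1).+1 ((i - r.-1).+1 + k)).
    by rewrite E /=; apply; rewrite /n; try lia; apply: mmd_antipodes; lia.
  - by have := bE (i - r.-1); have := bE (j - r.-1); case: ifP; case: ifP; lia.
rewrite negb_forall => /existsP[l lS]; have l_r := ltn_ord l.
have leaf i : i < r.-1 -> i != l -> tvertex (2 * k + m + i) \in S.
  move=> ir il; have := hit (2 * k + m + l) (2 * k + m + i).
  rewrite (negbTE lS) /=; apply; rewrite /n; try lia.
  by apply: mmd_leaves; rewrite /n; lia.
have anti j : k <= j <= k.+1 -> tvertex j \in S.
  move=> jk; have := hit (2 * k + m + l) j; rewrite (negbTE lS) /=; apply.
  - by rewrite /n; lia.
  - by rewrite /n; lia.
  - by lia.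
  - by apply: mmd_leaf_antipode; rewrite /n; lia.
pose b j := if tvertex j.+1 \in S then j.+1 else j.+1 + k.+1.
have bE j : b j = j.+1 \/ b j = j.+1 + k.+1 by rewrite /b; case: ifP; auto.
(* The last index has no partner on the cycle, so [b] takes the antipode [k]; the other antipode
   [k.+1] replaces the missing leaf [l] in the list. *)
have bkE j : j = k.-1 -> b j = k by move->; rewrite /b prednK ?anti //; lia.
exists (fun i => if i < r.-1 then if i == l then k.+1 else 2 * k + m + i
                 else b (i - r.-1)).
split=> [i ik|i ik|i j ik jk].
- have := bE (i - r.-1); have := bkE (i - r.-1); rewrite /n.
  by case: ifP => ?; [case: ifP|]; lia.
- case: ifP => [ir|ir].
    by have [_|il] := eqVneq i l; [apply: anti; lia|apply: leaf].
  have [E|E] := eqVneq (i - r.-1) k.-1; first by rewrite bkE // anti; lia.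
  rewrite /b; case: ifP => // F.
  move: (hit (i - r.-1).+1 ((i - r.-1).+1 + k.+1)).
  by rewrite F /=; apply; rewrite /n; try lia; apply: mmd_antipodes; lia.
have := bE (i - r.-1); have := bkE (i - r.-1).
have := bE (j - r.-1); have := bkE (j - r.-1).
by case: ifP => ?; [case: ifP => ?|]; (case: ifP => ?; [case: ifP => ?|]); lia.
Qed.

Lemma dim_s_tadpole : dim_s tadpole = r.-1 + k.
Proof.
apply/eqP; rewrite eqn_leq leq_dim_s_tadpole andbT.
(* All leaves together with the vertices [1, ..., k]; what is left lies on one geodesic to the end
   of the pendant path, itself a member of [S]. *)
pose f (i : 'I_(r.-1 + k)) :=
  tvertex (if i < r.-1 then 2 * k + m + i else (i - r.-1).+1).
pose S := [set f i | i : 'I_(r.-1 + k)].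
have leS : #|S| <= r.-1 + k by rewrite -[X in _ <= X]card_ord leq_imset_card.
apply: leq_trans leS; apply: (proj2 (dim_s_min _)).
have inS (x : tadpole) : x \notin S -> ~~ (0 < x <= k) /\ x < 2 * k + m.
  move=> xS; have x_n := ltn_ord x; rewrite {2}/n in x_n.
  split; last rewrite ltnNge; apply: contra xS => xk; apply/imsetP.
    have i_lt : r.-1 + x.-1 < r.-1 + k by lia.
    exists (Ordinal i_lt); rewrite ?inE //; apply: val_inj.
    by rewrite /f /= ltnNge leq_addr /= addKn prednK ?tvertexK //; lia.
  have i_r : x - (2 * k + m) < r.-1 by lia.
  have i_lt : x - (2 * k + m) < r.-1 + k by lia.
  exists (Ordinal i_lt); rewrite ?inE //; apply: val_inj.
  by rewrite /f /= i_r subnKC ?tvertexK //.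
have r0 : 0 < r.-1 by lia.
have e_n : 2 * k + m < n by rewrite /n; lia.
apply/forallP=> x; apply/forallP=> y; apply/implyP=> xy; apply/existsP.
have distE := tadpole_dist.2.
have [xS|/inS[xk xe]] := boolP (x \in S).
  by exists x; rewrite xS /strongly_resolves !distxx addn0 eqxx orbT.
have [yS|/inS[yk ye]] := boolP (y \in S).
  by exists y; rewrite yS /strongly_resolves !distxx addn0 eqxx.
exists (tvertex (2 * k + m)); apply/andP; split.
  apply/imsetP; have i_lt : 0 < r.-1 + k by lia.
  by exists (Ordinal i_lt); rewrite ?inE // /f /= r0 addn0.
rewrite /strongly_resolves !distE tvertexK //.
by case: (tdist_tail_end _ _ _ _ k1 m0 xk yk xe ye) => /eqP->; rewrite ?orbT.
Qed.

End TadpoleGraph.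

Theorem theorem11 (r t n : nat) (hr : 3 <= r) (hrt : r < t)
    (ht : 2 * t <= n + r - 2) :
  exists G : sgraph,
    [/\ connected G, #|G| = n, pd_s G = r & dim_s G = t].
Proof.
pose k := t - r + 1; pose m := n - (2 * k + r - 1).
(* The bound [r < t] makes the cycle length at least 5, and the upper bound on [t] amounts to
   [m >= 1]. *)
have k1 : 1 < k by rewrite /k; lia.
have m0 : 0 < m by rewrite /m /k; lia.
exists (tadpole k m r); split.
- exact: (tadpole_dist k m r hr k1 m0).1.
- by rewrite card_ord /m /k; lia.
- exact: pd_s_tadpole.
- by rewrite dim_s_tadpole // /k; lia.
Qed.
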